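(* For integers $k_0\ge1$ and $k\ge k_0+1$, let $\overline r$ be the minimum integer $r\ge1$ such that the system $$\sum_{j=1}^{k-k_0+1}\ \sum_{\substack{n_1+2n_2=\alpha\\ n_1,n_2\ge0}}\frac{c_j^2a_j^{n_1}b_j^{n_2}}{n_1!\,n_2!}=0,\qquad\alpha=1,\dots,r,$$ has no non-trivial real solution $(c_j,a_j,b_j)_{j=1}^{k-k_0+1}$. Then: (i) if $k-k_0=1$, $\overline r=4$; (ii) if $k-k_0=2$, $\overline r=6$; (iii) if $k-k_0\ge3$, $\overline r\ge7$.
   Context: A solution of the system is non-trivial if all of $c_1,\dots,c_{k-k_0+1}$ differ from $0$ and at least one of $a_1,\dots,a_{k-k_0+1}$ differs from $0$. *)

(* Defs.v *)
From mathcomp Require Import all_boot all_order all_algebra.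
From mathcomp Require Import reals.

Set Implicit Arguments.
Unset Strict Implicit.
Unset Printing Implicit Defensive.

Import Order.TTheory GRing.Theory Num.Theory.
Local Open Scope ring_scope.

(* The bounds n1, n2 <= alpha only make the inner sum finite: they follow from
   n1 + 2 n2 = alpha. *)
Definition equation_lhs (R : realType) (m : nat) (c a b : 'I_m -> R)
    (alpha : nat) : R :=
  \sum_(j < m) \sum_(n1 < alpha.+1)
    \sum_(n2 < alpha.+1 | (n1 + 2 * n2 == alpha)%N)
      (c j ^+ 2 * a j ^+ n1 * b j ^+ n2) / (n1`!%:R * n2`!%:R).

Definition solves_system (R : realType) (m r : nat) (c a b : 'I_m -> R) : Prop :=
  forall alpha : nat, (1 <= alpha <= r)%N -> equation_lhs c a b alpha = 0.

Definition nontrivial (R : realType) (m : nat) (c a : 'I_m -> R) : Prop :=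
  (forall j, c j <> 0) /\ (exists j, a j <> 0).

Definition no_nontrivial_solution (R : realType) (m r : nat) : Prop :=
  ~ exists c a b : 'I_m -> R, solves_system r c a b /\ nontrivial c a.

Definition is_rbar (R : realType) (k0 k r : nat) : Prop :=
  let m := (k - k0 + 1)%N in
  [/\ (1 <= r)%N, no_nontrivial_solution R m r
    & forall s : nat, (1 <= s)%N -> no_nontrivial_solution R m s -> (r <= s)%N].

(* Main.v *)
(** Let [heat b] be the flow [exp(b D^2)] on real polynomials.  Then
    [(heat b 'X^k).[a]] is [k!] times the inner sum of the [k]-th equation, so a
    solution of the first [r] equations is an identity
    [\sum_j c_j^2 (heat (b_j) f).[a_j] = (\sum_j c_j^2) f.[0]], valid for all
    [f] of degree at most [r].

    If [r = 2m] there is none.  Among the points [(a_j, b_j)] and the origin let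
    [z] be one with the largest second coordinate, and let [f <> 0], of degree at
    most [2m], be such that [heat b f] has a double root at [a] for every other
    point [(a, b)].  By the variation diminishing property of the heat flow,
    [heat (b + t) f] has for [t > 0] at most as many real roots, counted with
    multiplicity, as [heat b f] has sign changes; hence two roots are lost at each
    double root.  Once all the other points are passed no root is left for [z],
    so the identity for [f] only involves the total weight at [z], which is
    nonzero because the [c_j^2] are positive. *)
Require Import Defs.
From mathcomp Require Import all_boot all_order all_algebra.
From mathcomp Require Import reals.
From mathcomp Require Import boolp topology normedtype derive zify ring lra.
From mathcomp Require Import polyrcf.

Set Implicit Arguments.
Unset Strict Implicit.
Unset Printing Implicit Defensive.

Import Order.TTheory GRing.Theory Num.Theory. Import numFieldNormedType.Exports.
Local Open Scope ring_scope.

(** * The heat flow on polynomials *)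

(* [heat b] conjugates multiplication by ['X] to [hermite_op b]; this defines it
   by Horner's scheme. *)
Definition hermite_op (R : comNzRingType) (b : R) (p : {poly R}) : {poly R} :=
  p * 'X + (2 * b) *: p^`().

Definition heat (R : comNzRingType) (b : R) (f : {poly R}) : {poly R} :=
  foldr (fun c p => hermite_op b p + c%:P) 0 f.

Lemma hermite_op0 (R : comNzRingType) (b : R) : hermite_op b 0 = 0.
Proof. by rewrite /hermite_op mul0r deriv0 scaler0 addr0. Qed.

Lemma hermite_opD (R : comNzRingType) (b : R) p q :
  hermite_op b (p + q) = hermite_op b p + hermite_op b q.
Proof. by rewrite /hermite_op mulrDl derivD scalerDr addrACA. Qed.

Lemma hermite_opZ (R : comNzRingType) (b k : R) p :
  hermite_op b (k *: p) = k *: hermite_op b p.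
Proof.
by rewrite /hermite_op derivZ scalerDr scalerAl !scalerA (mulrC k).
Qed.

Lemma heat0 (R : comNzRingType) (b : R) : heat b 0 = 0.
Proof. by rewrite /heat polyseq0. Qed.

Lemma heat_MXaddC (R : comNzRingType) (b : R) f c :
  heat b (f * 'X + c%:P) = hermite_op b (heat b f) + c%:P.
Proof.
rewrite -cons_poly_def /heat polyseq_cons; case: nilP => //= ->.
rewrite polyseqC; case: eqP => [->|_] /=; by rewrite hermite_op0 add0r.
Qed.

Lemma heatMX (R : comNzRingType) (b : R) f :
  heat b (f * 'X) = hermite_op b (heat b f).
Proof. by rewrite -[f * 'X]addr0 heat_MXaddC addr0. Qed.

Lemma heatC (R : comNzRingType) (b c : R) : heat b c%:P = c%:P.
Proof.
by rewrite -{1}[c%:P]add0r -(mul0r 'X) heat_MXaddC heat0 hermite_op0 add0r.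
Qed.

Lemma heatD (R : comNzRingType) (b : R) f g :
  heat b (f + g) = heat b f + heat b g.
Proof.
elim/poly_ind: f g => [|f c IH] g; first by rewrite heat0 !add0r.
elim/poly_ind: g => [|g d _]; first by rewrite heat0 !addr0.
rewrite addrACA -mulrDl -polyCD !heat_MXaddC IH hermite_opD polyCD.
by rewrite addrACA.
Qed.

Lemma heatZ (R : comNzRingType) (b k : R) f : heat b (k *: f) = k *: heat b f.
Proof.
elim/poly_ind: f => [|f c IH]; first by rewrite heat0 !scaler0 heat0.
have -> : k *: (f * 'X + c%:P) = (k *: f) * 'X + (k * c)%:P.
  by rewrite scalerDr scalerAl polyCM (mul_polyC k).
by rewrite !heat_MXaddC IH hermite_opZ polyCM (mul_polyC k) -scalerDr.
Qed.

Lemma heat_deriv (R : comNzRingType) (b : R) f : heat b f^`() = (heat b f)^`().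
Proof.
elim/poly_ind: f => [|f c IH]; first by rewrite heat0 !deriv0 heat0.
rewrite heat_MXaddC !derivD derivM derivX mulr1 !derivC !addr0 heatD heatMX IH.
by rewrite derivZ derivM derivX mulr1 addrAC.
Qed.

(** The flow turns a factor ['X] into $X + 2bD$ and commutes with $D$, so the two times add up.
    Horner induction then yields the semigroup law. *)
Lemma heat_hermite_op (R : comNzRingType) (b b' : R) f :
  heat b (hermite_op b' f) = hermite_op (b + b') (heat b f).
Proof.
rewrite {1}/hermite_op heatD heatMX heatZ heat_deriv /hermite_op.
by rewrite -addrA -scalerDl -mulrDr.
Qed.

Lemma heat_heat (R : comNzRingType) (b b' : R) f :
  heat b (heat b' f) = heat (b + b') f.
Proof.
elim/poly_ind: f => [|f c IH]; first by rewrite !heat0.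
by rewrite !heat_MXaddC heatD heatC heat_hermite_op IH.
Qed.

Lemma heat_id (R : comNzRingType) (f : {poly R}) : heat 0 f = f.
Proof.
elim/poly_ind: f => [|f c IH]; first by rewrite heat0.
by rewrite heat_MXaddC IH /hermite_op mulr0 scale0r addr0.
Qed.

Lemma heat_eq0 (R : comNzRingType) (b : R) f : (heat b f == 0) = (f == 0).
Proof.
apply/eqP/eqP => [f0|->]; last exact: heat0.
by rewrite -[f]heat_id -(addNr b) -heat_heat f0 heat0.
Qed.

Lemma size_hermite_op (R : comNzRingType) (b : R) p :
  (size (hermite_op b p) <= (size p).+1)%N.
Proof.
have [->|p0] := eqVneq p 0; first by rewrite hermite_op0 size_poly0.
apply: leq_trans (size_polyD _ _) _; rewrite geq_max size_mulX ?leqnn //=.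
apply: leq_trans (size_scale_leq _ _) _.
by apply/ltnW/(ltn_trans (lt_size_deriv p0)).
Qed.

Lemma size_heat (R : comNzRingType) (b : R) f : (size (heat b f) <= size f)%N.
Proof.
elim/poly_ind: f => [|f c IH]; first by rewrite heat0.
rewrite heat_MXaddC size_MXaddC.
have [->|f0] /= := eqVneq f 0.
  by rewrite heat0 hermite_op0 add0r size_polyC; case: eqP.
apply: leq_trans (size_polyD _ _) _; rewrite geq_max size_polyC.
rewrite (leq_trans (size_hermite_op _ _)) ?ltnS //.
by case: (c != 0).
Qed.

Lemma natr_neq0_fact (R : fieldType) n :
  (forall k, k.+1%:R != 0 :> R) -> n`!%:R != 0 :> R.
Proof.
move=> char0; elim: n => [|n IH]; first by rewrite oner_eq0.
by rewrite factS natrM mulf_neq0.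
Qed.

(** The exponential series of $bD^2$, compared with Horner's scheme. In the derivative of order
    $2n+2$ of [f * 'X], Leibniz's rule produces $2n+2$ copies of the derivative of order $2n+1$ of
    [f]; they make up the term of index $n$ in the $2bD$ part of [hermite_op]. *)
Lemma heat_expansion (R : fieldType) (b : R) N (f : {poly R}) :
  (forall n, n.+1%:R != 0 :> R) -> (size f <= N)%N ->
  heat b f = \sum_(n < N) (b ^+ n / n`!%:R) *: f^`(2 * n).
Proof.
move=> char0.
elim/poly_ind: f => [|f c IH] szf.
  by rewrite heat0 big1 // => n _; rewrite derivn_poly0 ?size_poly0 ?scaler0.
case: N IH szf => [|N] IH szf.
  by move: szf; rewrite size_poly_leq0 => /eqP ->; rewrite heat0 big_ord0.
have [->|f0] := eqVneq f 0.
  rewrite mul0r add0r heatC big_ord_recl muln0 derivn0 big1 => [|n _].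
    by rewrite expr0 fact0 divr1 scale1r addr0.
  by rewrite derivn_poly0 ?scaler0 // size_polyC /bump /=; case: (c != 0).
have szf' : (size f <= N)%N by move: szf; rewrite size_MXaddC (negPf f0).
rewrite heat_MXaddC IH; last exact: leqW.
rewrite /hermite_op mulr_suml raddf_sum scaler_sumr.
rewrite [in RHS]big_ord_recl muln0 derivn0 expr0 fact0 divr1 scale1r.
rewrite big_ord_recl muln0 derivn0 expr0 fact0 divr1 scale1r.
rewrite [X in _ + X + _ = _]big_ord_recr /= derivZ -derivnS.
rewrite (@derivn_poly0 _ _ (2 * N).+1); last first.
  by apply: leq_trans szf' _; rewrite mul2n -addnn -addnS leq_addr.
rewrite !scaler0 addr0 -!addrA; congr (_ + _).
rewrite addrA [RHS]addrC; congr (_ + _).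
rewrite -big_split; apply: eq_bigr => n _ /=; rewrite -!derivnS.
have -> : ((0 + n + 1 * bump 0 n)%coq_nat).+1 = (2 * n).+2.
  by rewrite /bump leq0n; lia.
rewrite /bump leq0n add1n derivnMXaddC scalerDr addrC scalerAl; congr (_ + _).
rewrite derivZ -derivnS -scaler_nat !scalerA; congr (_ *: _).
have hn := char0 n; have hf := natr_neq0_fact n char0.
have -> : (2 * n).+2 = (2 * n.+1)%N by lia.
by rewrite factS exprS !natrM; field; rewrite hf; move: hn; rewrite -natr1 addrC => ->.
Qed.

Lemma derivn_hermite_op (R : comNzRingType) (b : R) p k :
  (hermite_op b p)^`(k.+1) = hermite_op b p^`(k.+1) + p^`(k) *+ k.+1.
Proof.
rewrite /hermite_op derivnD -[p * 'X]addr0 derivnMXaddC derivnZ -derivSn.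
by rewrite [RHS]addrC addrA addrAC -derivnS.
Qed.

Lemma hermite_opM (R : comNzRingType) (b : R) p q :
  hermite_op b (p * q) = p * hermite_op b q + (2 * b) *: (p^`() * q).
Proof.
rewrite /hermite_op derivM scalerDr mulrDr -!mulrA -!scalerAr -addrA.
by congr (_ + _); rewrite addrC.
Qed.

Lemma hermite_op_sum (R : comNzRingType) (b : R) I (r : seq I) (F : I -> {poly R}) :
  hermite_op b (\sum_(i <- r) F i) = \sum_(i <- r) hermite_op b (F i).
Proof.
elim: r => [|i r IH]; first by rewrite !big_nil hermite_op0.
by rewrite !big_cons hermite_opD IH.
Qed.

(* Wick's formula: [heat b f] at [x] is the expectation of [f] under the
   Gaussian law of mean [x] and variance [2 b]. *)
Lemma heatM (R : fieldType) (b : R) N (f g : {poly R}) :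
  (forall k, k.+1%:R != 0 :> R) -> (size g <= N)%N ->
  heat b (f * g) = \sum_(k < N)
    ((2 * b) ^+ k / k`!%:R) *: ((heat b f)^`(k) * (heat b g)^`(k)).
Proof.
move=> char0; elim/poly_ind: g N => [|g c IH] N szg.
  rewrite mulr0 !heat0 big1 // => k _.
  by rewrite (@derivn_poly0 _ 0) ?size_poly0 // mulr0 scaler0.
case: N szg => [|N] szg.
  by move: szg; rewrite size_poly_leq0 => /eqP ->; rewrite mulr0 heat0 big_ord0.
have szg' : (size g <= N)%N.
  move: szg; rewrite size_MXaddC; case: ifP => // /andP[/eqP -> _] _.
  by rewrite size_poly0.
rewrite mulrDr mulrA heatD heatMX (IH N.+1); last exact: leqW.
rewrite (mulrC f) mul_polyC heatZ heat_MXaddC hermite_op_sum.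
rewrite [in RHS]big_ord_recl derivn0 expr0 fact0 divr1 scale1r.
under eq_bigr do rewrite hermite_opZ hermite_opM scalerDr.
rewrite big_split /= big_ord_recl derivn0 expr0 fact0 divr1 scale1r.
rewrite [X in _ + X + _ = _]big_ord_recr /= (@derivn_poly0 _ (heat b g) N); last first.
  exact: leq_trans (size_heat _ _) szg'.
rewrite mulr0 !scaler0 addr0 [X in _ = X + _]mulrDr (mulrC _ c%:P) mul_polyC.
rewrite addrAC [X in X + _ = _]addrAC -[LHS]addrA; congr (_ + _).
rewrite -big_split /=; apply: eq_bigr => k _.
rewrite /bump leq0n !add1n !add0n -!derivnS. rewrite derivnD derivnC addr0.
rewrite derivn_hermite_op [X in _ = _ *: X]mulrDr [RHS]scalerDr.
congr (_ + _).
rewrite mulrnAr -scaler_nat !scalerA; congr (_ *: _).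
rewrite factS exprS natrM; move: (char0 k) (natr_neq0_fact k char0).
by rewrite -natr1 addrC => h1 h2; field; rewrite h2 h1.
Qed.

(** * Positivity of the heat flow *)

Lemma heat_sqr_gt0 (R : realFieldType) (b : R) (f : {poly R}) x :
  0 < b -> f != 0 -> 0 < (heat b (f ^+ 2)).[x].
Proof.
move=> b0 f0; have char0 k : k.+1%:R != 0 :> R by rewrite pnatr_eq0.
(* Wick's formula gives a sum of squares with positive coefficients, and the term whose order is the
   degree of [F] is a nonzero constant. *)
rewrite expr2 (heatM b f char0 (leqnn _)) horner_sum.
set F := heat b f; have F0 : F != 0 by rewrite heat_eq0.
have term_ge0 k : 0 <= (((2 * b) ^+ k / k`!%:R) *: (F^`(k) * F^`(k))).[x].
  by rewrite hornerZ hornerM mulr_ge0 ?sqr_ge0 // divr_ge0 // exprn_ge0 // mulr_ge0 // ltW.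
have szF : ((size F).-1 < size f)%N.
  apply: leq_trans (size_heat b f); rewrite prednK // lt0n size_poly_eq0 //.
rewrite (bigD1 (Ordinal szF)) //=; apply: ltr_wpDr.
  by apply: sumr_ge0 => k _; exact: term_ge0.
have -> : F^`((size F).-1) = (lead_coef F *+ (size F).-1 ^_ (size F).-1)%:P.
  apply/polyP => -[|i]; rewrite coef_derivn coefC ?addn0 //=.
  rewrite nth_default ?mul0rn // addnS -addSn prednK ?leq_addr //.
  by rewrite lt0n size_poly_eq0.
rewrite -polyCM hornerZ hornerC -expr2 ffactnn mulr_gt0 //.
  by rewrite divr_gt0 // ?exprn_gt0 ?mulr_gt0 // ltr0n fact_gt0.
by rewrite exprn_even_gt0 //= -mulr_natr mulf_neq0 ?lead_coef_eq0 // pnatr_eq0 -lt0n fact_gt0.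
Qed.

Lemma ge0_poly_coercive (R : realFieldType) (p : {poly R}) (C : R) :
  (forall x, 0 <= p.[x]) -> (1 < size p)%N ->
  exists B, forall x, B <= x -> C <= p.[x].
Proof.
move=> p_ge0 szp.
have lc_gt0 : 0 < lead_coef p.
  rewrite lt_neqAle eq_sym lead_coef_eq0 -size_poly_gt0 (ltnW szp) /= leNgt.
  apply/negP => lcN.
  have [|B HB] := @poly_pinfty_gt_lc _ (- p).
    by rewrite lead_coefN oppr_gt0.
  have := HB B (lexx _); rewrite lead_coefN hornerN lerN2 => h.
  by have := lt_le_trans lcN (p_ge0 B); rewrite ltNge => /negP[]; apply: le_trans h.
have szC : (size (- C%:P) < size p)%N.
  by rewrite size_polyN (leq_ltn_trans (size_polyC_leq1 _)).
have [|B HB] := @poly_pinfty_gt_lc _ (p - C%:P).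
  by rewrite lead_coefDl.
exists B => x /HB; rewrite lead_coefDl // hornerD hornerN hornerC => h.
by rewrite -subr_ge0 (le_trans _ h) // ltW.
Qed.

(** The polynomial exceeds its value at 0 outside a compact interval; the left end is handled by the
    substitution $x \mapsto -x$. *)
Lemma ge0_poly_min (R : realType) (p : {poly R}) :
  (forall x, 0 <= p.[x]) -> (1 < size p)%N ->
  exists x0, forall x, p.[x0] <= p.[x].
Proof.
move=> p_ge0 szp; have [B1 HB1] := ge0_poly_coercive p.[0] p_ge0 szp.
have [| |B2 HB2] := @ge0_poly_coercive _ (p \Po (- 'X)) p.[0].
- by move=> x; rewrite horner_comp.
- by rewrite size_comp_poly2 // size_polyN size_polyX.
pose B := Num.max 0 (Num.max B1 B2).
have B0 : - B <= B by rewrite ge0_cp // /B le_max lexx.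
have [|c _ Hc] := @EVT_min R (horner p) (- B) B B0.
  by apply: continuous_subspaceT; exact: continuous_horner.
exists c => x; have [xB|xB] := boolP (x \in `[- B, B]); first exact: Hc.
have c0 : p.[c] <= p.[0].
  by apply: Hc; rewrite in_itv /= oppr_le0 /B le_max lexx.
apply: le_trans c0 _; move: xB; rewrite in_itv /= negb_and -!ltNge.
case/orP => xB; last first.
  by apply: HB1; apply: le_trans (ltW xB); rewrite /B !le_max lexx orbT.
have := HB2 (- x); rewrite horner_comp hornerN hornerX opprK; apply.
by rewrite lerNr; apply: le_trans (ltW xB) _; rewrite lerN2 /B !le_max lexx !orbT.
Qed.

(** If [p.[x0]] were negative, the intermediate value theorem would give a point to the right of
    [x0] where [p] equals half of it. *)
Lemma poly_ge0_right (R : rcfType) (p : {poly R}) x0 :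
  (forall x, x0 < x -> 0 <= p.[x]) -> 0 <= p.[x0].
Proof.
move=> p_ge0; rewrite leNgt; apply/negP => p0.
have p1 : 0 <= p.[x0 + 1] by rewrite p_ge0 // ltrDl.
have x01 : x0 <= x0 + 1 by rewrite lerDl.
have [|y /andP[y_ge _]] := @poly_ivt _ (p - (p.[x0] / 2)%:P) x0 (x0 + 1) x01.
  by rewrite !(hornerD, hornerN, hornerC); nra.
rewrite rootE !(hornerD, hornerN, hornerC).
rewrite subr_eq0 => /eqP py.
have [y0|y0] := eqVneq y x0; first by move: py; rewrite y0; lra.
by have := p_ge0 y; rewrite lt_neqAle eq_sym y0 y_ge => /(_ isT); lra.
Qed.

Lemma poly_ge0_left (R : rcfType) (p : {poly R}) x0 :
  (forall x, x < x0 -> 0 <= p.[x]) -> 0 <= p.[x0].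
Proof.
move=> p_ge0; have := @poly_ge0_right _ (p \Po (- 'X)) (- x0).
rewrite horner_comp hornerN hornerX opprK; apply => x x0x.
by rewrite horner_comp hornerN hornerX p_ge0 // ltrNl.
Qed.

(** [x0] is a global minimum, hence a double root of [q - q(x0)]. Iterating this replaces a
    decomposition into sums of squares. *)
Lemma ge0_poly_split (R : realType) (q : {poly R}) :
  (forall x, 0 <= q.[x]) -> (1 < size q)%N ->
  exists x0 q1, [/\ q = (q.[x0])%:P + ('X - x0%:P) ^+ 2 * q1
                  & forall x, 0 <= q1.[x]].
Proof.
move=> q_ge0 szq; have [x0 x0_min] := ge0_poly_min q_ge0 szq.
have /factor_theorem[g gE] : root (q - (q.[x0])%:P) x0.
  by rewrite rootE hornerD hornerN hornerC subrr.
have hg x : g.[x] * (x - x0) = q.[x] - q.[x0].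
  have /(congr1 (horner^~ x)) := gE.
  by rewrite !(hornerD, hornerN, hornerM, hornerX, hornerC).
(* By minimality [g] is non-negative to the right of [x0] and non-positive to the left, so it
   vanishes at [x0]. *)
have /factor_theorem[q1 q1E] : root g x0.
  rewrite rootE eq_le; apply/andP; split; last first.
    apply: poly_ge0_right => x xx0.
    by have := x0_min x; rewrite -subr_ge0 -hg pmulr_lge0 // subr_gt0.
  rewrite -oppr_ge0 -hornerN; apply: poly_ge0_left => x xx0.
  by have := x0_min x; rewrite -subr_ge0 -hg nmulr_lge0 ?subr_lt0 // hornerN oppr_ge0.
have q1_gt x : x0 < x -> 0 <= q1.[x].
  move=> xx0; have := x0_min x; rewrite -subr_ge0 -hg q1E.
  rewrite hornerM hornerD hornerN hornerX hornerC -mulrA pmulr_lge0 //.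
  by rewrite mulr_gt0 // subr_gt0.
exists x0, q1; split.
  by rewrite -[LHS](subrK (q.[x0])%:P) gE q1E addrC -mulrA -expr2 mulrC.
move=> x; have [xx0|xx0|->] := ltgtP x x0; last exact: poly_ge0_right.
  have := x0_min x; rewrite -subr_ge0 -hg q1E.
  rewrite hornerM hornerD hornerN hornerX hornerC -mulrA pmulr_lge0 //.
  by rewrite nmulr_lgt0 ?subr_lt0.
exact: q1_gt.
Qed.

Lemma heat_gt0 (R : realType) (b : R) (q : {poly R}) x :
  0 < b -> (forall y, 0 <= q.[y]) -> q != 0 -> 0 < (heat b q).[x].
Proof.
move=> b0 q_ge0 q0; rewrite -[q]mul1r -(expr1n _ 2).
have: (1 : {poly R}) != 0 by rewrite oner_eq0.
(* The constant 1 is generalized to any [f != 0]: the claim becomes positivity for [f ^+ 2 * q], and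
   each splitting of [q] moves a factor $(X - x_0)^2$ into the square. *)
have [n] := ubnP (size q); elim: n q 1 q_ge0 q0 => // n IH q f q_ge0 q0 szq f0.
have [szq1|szq1] := leqP (size q) 1.
  move: q_ge0 q0; rewrite (size1_polyC szq1) polyC_eq0 => /(_ 0).
  rewrite hornerC mulrC mul_polyC heatZ hornerZ => c_ge0 c0.
  by rewrite mulr_gt0 ?heat_sqr_gt0 // lt_neqAle eq_sym c0.
have [x0 [q1 [qE q1_ge0]]] := ge0_poly_split q_ge0 szq1.
have [q10|q10] := eqVneq q1 0.
  by move: szq1; rewrite qE q10 mulr0 addr0 ltnNge size_polyC_leq1.
rewrite qE mulrDr mulrA -exprMn mulrC mul_polyC heatD heatZ hornerD hornerZ.
apply: ltr_wpDl; first by rewrite mulr_ge0 // ltW // heat_sqr_gt0.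
apply: IH => //; last by rewrite mulf_neq0 // polyXsubC_eq0.
have szle : (size (q.[x0])%:P < size (('X - x0%:P) ^+ 2 * q1)%R)%N.
  rewrite mulrC size_Mmonic ?monic_exp ?monicXsubC // size_exp_XsubC.
  by rewrite (leq_ltn_trans (size_polyC_leq1 _)) // addn3.
move: szq; rewrite qE addrC size_polyDl //.
by rewrite mulrC size_Mmonic ?monic_exp ?monicXsubC // size_exp_XsubC /=; lia.
Qed.

(** * Real roots along the heat flow *)

Lemma mem_rootsR (R : rcfType) (p : {poly R}) x :
  p != 0 -> (x \in rootsR p) = root p x.
Proof. by move=> /roots_on_rootsR/(_ x) <-; rewrite in_itv. Qed.

Lemma sorted_rootsR (R : rcfType) (p : {poly R}) : sorted <%R (rootsR p).
Proof. exact: sorted_roots. Qed.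

Lemma uniq_rootsR (R : rcfType) (p : {poly R}) : uniq (rootsR p).
Proof. exact: lt_sorted_uniq (sorted_rootsR p). Qed.

(** Powers of distinct linear factors are coprime. Comparing degrees then bounds the number of
    roots. *)
Lemma prod_XsubC_mup_dvdp (F : fieldType) (p : {poly F}) (s : seq F) :
  p != 0 -> uniq s -> \prod_(x <- s) ('X - x%:P) ^+ mup x p %| p.
Proof.
move=> p0; elim: s => [|x s IH] /=; first by rewrite big_nil dvd1p.
case/andP => xs us; rewrite big_cons Gauss_dvdp ?IH // -?mup_geq ?leqnn //.
apply: coprimep_expl; rewrite coprimep_sym coprimep_XsubC rootE horner_prod.
rewrite prodf_seq_neq0; apply/allP => y ys /=.
rewrite horner_exp expf_neq0 // hornerXsubC subr_eq0.
by apply: contraNneq xs => ->.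
Qed.

Definition root_count (R : rcfType) (p : {poly R}) : nat :=
  \sum_(x <- rootsR p) mup x p.

Lemma root_count_lt_size (R : rcfType) (p : {poly R}) :
  p != 0 -> (root_count p < size p)%N.
Proof.
move=> p0; have := prod_XsubC_mup_dvdp p0 (uniq_rootsR p).
move=> /(dvdp_leq p0); apply: leq_trans; rewrite /root_count.
elim: (rootsR p) => [|x s IH]; first by rewrite !big_nil size_poly1.
rewrite !big_cons size_Mmonic ?monic_prod ?monic_neq0 // => [||i _];
  rewrite ?monic_exp ?monicXsubC //.
by rewrite size_exp_XsubC; move: IH; lia.
Qed.

Lemma sum_mup_le_root_count (R : rcfType) (p : {poly R}) (s : seq R) :
  p != 0 -> uniq s -> (\sum_(x <- s) mup x p <= root_count p)%N.
Proof.
move=> p0 us; rewrite (bigID (root p)) /= [X in (_ + X)%N]big1 ?addn0.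
  rewrite -big_filter /root_count.
  apply: (uniq_sub_le_big leqnn (fun m n => leq_addr n m)).
  - by rewrite filter_uniq.
  - exact: uniq_rootsR.
  by move=> x; rewrite mem_filter mem_rootsR // => /andP[].
by move=> x; exact: mupNroot.
Qed.

(** The conjugate under [heat b] of multiplication by $X - r$; see [heatMXsubC]. *)
Definition shifted_op (R : comNzRingType) (b r : R) (p : {poly R}) : {poly R} :=
  p * ('X - r%:P) + (2 * b) *: p^`().

Lemma heatMXsubC (R : comNzRingType) (b r : R) f :
  heat b (f * ('X - r%:P)) = shifted_op b r (heat b f).
Proof.
rewrite /shifted_op !mulrBr heatD -scaleN1r heatZ heatMX (mulrC f) mul_polyC.
by rewrite heatZ /hermite_op (mulrC _ r%:P) mul_polyC scaleN1r addrAC.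
Qed.

Lemma shifted_opMX (R : comNzRingType) (b r x : R) (h : {poly R}) k :
  shifted_op b r (h * ('X - x%:P) ^+ k.+1) =
  ('X - x%:P) ^+ k *
    (shifted_op b r h * ('X - x%:P) + (2 * b * k.+1%:R) *: h).
Proof.
rewrite /shifted_op derivM deriv_exp derivXsubC mul1r exprS /=.
rewrite -!mul_polyC -mulr_natr !polyCM !polyC_natr; ring.
Qed.

Lemma mup_shifted_op (R : fieldType) (b r x : R) (p : {poly R}) :
  p != 0 -> shifted_op b r p != 0 -> (mup x p <= (mup x (shifted_op b r p)).+1)%N.
Proof.
move=> p0 T0; case Dk: (mup x p) => [//|k]; rewrite ltnS mup_geq //.
have : (k.+1 <= mup x p)%N by rewrite Dk.
by rewrite mup_geq // => /dvdpP[h ->]; rewrite shifted_opMX dvdp_mulIl.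
Qed.

(* Rolle's theorem for [exp((x - r)^2 / 4b) p(x)], whose derivative is
   [shifted_op b r p] up to the positive factor [exp((x - r)^2 / 4b) / 2b]. *)
Lemma shifted_op_rolle (R : rcfType) (b r a c : R) (p : {poly R}) :
  0 < b -> p != 0 -> a < c -> root p a -> root p c ->
  (forall x, a < x < c -> ~~ root p x) ->
  exists2 y, a < y < c & root (shifted_op b r p) y.
Proof.
move=> b0 p0 ac pa pc pN.
have [k [g]] := multiplicity_XsubC p a; rewrite p0 /= => ga pE.
case: k pE => [|k] pE; first by move: ga; rewrite -[g]mulr1 -(expr0 ('X - a%:P)) -pE pa.
have g0 : g != 0 by apply: contraNneq p0 => g0; rewrite pE g0 mul0r.
have [l [h]] := multiplicity_XsubC g c; rewrite g0 /= => hc gE.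
have gc : root g c.
  move: pc; rewrite pE rootM => /orP[//|].
  by rewrite root_exp_XsubC gt_eqF.
case: l gE => [|l] gE; first by move: hc; rewrite -[h]mulr1 -(expr0 ('X - c%:P)) -gE gc.
have ha : ~~ root h a by apply: contra ga; rewrite gE rootM => ->.
have hN x : a < x < c -> ~~ root h x.
  by move=> /pN; apply: contra; rewrite pE gE !rootM => ->.
(* With the roots at [a] and [c] divided out, [h] has no root on the closed interval and keeps its
   sign there. *)
have hac : 0 < h.[a] * h.[c].
  rewrite ltNge; apply/negP => hle; have [x] := polyrcf.poly_ivt (ltW ac) hle.
  rewrite in_itv /= => /andP[ax xc] hx.
  have /hN : a < x < c.
    rewrite !lt_neqAle ax xc !andbT; apply/andP; split.
      by apply: contraNneq ha => ->.
    by apply: contraNneq hc => <-.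
  by rewrite hx.
(* [W] is what remains of [shifted_op b r p] after one power less of each factor is taken out. Its
   values at [a] and [c] are positive multiples of $h(a)(a-c)$ and $h(c)(c-a)$, so they have
   opposite signs. *)
pose W := (shifted_op b r h * ('X - c%:P) + (2 * b * l.+1%:R) *: h) * ('X - a%:P)
          + (2 * b * k.+1%:R) *: (h * ('X - c%:P)).
have TE : shifted_op b r p = ('X - a%:P) ^+ k * ('X - c%:P) ^+ l * W.
  rewrite pE shifted_opMX gE shifted_opMX.
  by rewrite /W -!mul_polyC exprS; ring.
have Wa : W.[a] = 2 * b * k.+1%:R * (h.[a] * (a - c)).
  by rewrite /W !(hornerD, hornerM, hornerZ, hornerN, hornerX, hornerC); ring.
have Wc : W.[c] = 2 * b * l.+1%:R * h.[c] * (c - a).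
  by rewrite /W !(hornerD, hornerM, hornerZ, hornerN, hornerX, hornerC); ring.
have Wac : W.[a] * W.[c] < 0.
  have -> : W.[a] * W.[c] =
      - ((2 * b * k.+1%:R) * (2 * b * l.+1%:R) * (h.[a] * h.[c]) * (c - a) ^+ 2).
    by rewrite Wa Wc; ring.
  have coef_gt0 n : 0 < 2 * b * n.+1%:R by rewrite !mulr_gt0.
  rewrite oppr_lt0; apply: mulr_gt0; last by rewrite exprn_gt0 ?subr_gt0.
  by apply: mulr_gt0 => //; apply: mulr_gt0.
have [y] := polyrcf.poly_ivt (ltW ac) (ltW Wac).
rewrite in_itv /= => /andP[ay yc] Wy; exists y; last first.
  by rewrite TE rootM Wy orbT.
rewrite !lt_neqAle ay yc !andbT; apply/andP; split; apply/eqP => yE; move: Wac.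
  by rewrite yE (rootP Wy) mul0r ltxx.
by rewrite -yE (rootP Wy) mulr0 ltxx.
Qed.

(** Rolle's theorem in each gap between consecutive roots of [p], the induction moving the leftmost
    root [a] to the right. *)
Lemma shifted_op_interlace (R : rcfType) (b r a : R) (p : {poly R}) (s : seq R) :
  0 < b -> p != 0 -> path <%R a s -> root p a ->
  (forall x, a < x -> root p x = (x \in s)) ->
  exists ys, [/\ size ys = size s, path <%R a ys,
    all (root (shifted_op b r p)) ys & all (predC (root p)) ys].
Proof.
move=> b0 p0; elim: s a => [|c s IH] a /=; first by exists [::].
case/andP => ac cs pa ps.
have pc : root p c by rewrite ps // mem_head.
have /allP c_min := lt_path_min cs.
have [|ys [szys cys rys nys]] := IH c cs pc.
  move=> x cx; rewrite ps ?(lt_trans ac) // inE.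
  by rewrite gt_eqF.
have [|y /andP[ay yc] Ty] := shifted_op_rolle r b0 p0 ac pa pc.
  move=> x /andP[ax xc]; rewrite ps // inE negb_or lt_eqF //=.
  by apply/negP => /c_min /(lt_trans xc); rewrite ltxx.
exists (y :: ys); split => /=.
- by rewrite szys.
- by rewrite ay (path_le lt_trans yc cys).
- by rewrite Ty.
rewrite nys andbT /= ps // inE negb_or lt_eqF //=.
by apply/negP => /c_min /(lt_trans yc); rewrite ltxx.
Qed.

(** Each of the $n$ distinct roots of [p] loses at most one unit of multiplicity, and Rolle's
    theorem supplies $n - 1$ new roots between them, so the net loss is at most one. *)
Lemma root_count_shifted_op (R : rcfType) (b r : R) (p : {poly R}) :
  0 < b -> p != 0 -> shifted_op b r p != 0 ->
  (root_count p <= (root_count (shifted_op b r p)).+1)%N.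
Proof.
move=> b0 p0 T0; set T := shifted_op b r p.
have mem_s x := mem_rootsR x p0; have sorted_s := sorted_rootsR p.
have uniq_s := uniq_rootsR p; rewrite {1}/root_count.
move: (rootsR p) mem_s sorted_s uniq_s => [|a s] mem_s sorted_s uniq_s.
  by rewrite big_nil.
have [] := @shifted_op_interlace _ b r a p s b0 p0 sorted_s.
- by rewrite -mem_s mem_head.
- by move=> x ax; rewrite -mem_s inE gt_eqF.
move=> ys [szys path_ys /allP rys /allP nys].
have /(sum_mup_le_root_count T0) : uniq ((a :: s) ++ ys).
  rewrite cat_uniq uniq_s (lt_sorted_uniq (path_sorted path_ys)) andbT /=.
  by apply/hasPn => y /nys; rewrite mem_s.
rewrite big_cat /=.
have root_ys : (size s <= \sum_(y <- ys) mup y T)%N.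
  rewrite -szys -sum1_size !big_seq; apply: leq_sum => y /rys Ty.
  by rewrite -XsubC_dvd // dvdp_XsubCl.
have mup_s : (\sum_(x <- a :: s) mup x p <= \sum_(x <- a :: s) mup x T + (size s).+1)%N.
  rewrite -[(size s).+1]/(size (a :: s)) -sum1_size -big_split /=.
  by apply: leq_sum => x _; rewrite addn1 mup_shifted_op.
move=> count_ge; apply: leq_trans mup_s _; rewrite addnS ltnS.
by apply: leq_trans count_ge; rewrite leq_add2l.
Qed.

(** Squares $(X - x)^2$ are divided out as long as there is a root; a polynomial without roots has
    constant sign by the intermediate value theorem. *)
Lemma even_mup_constant_sign (R : rcfType) (p : {poly R}) :
  p != 0 -> (forall x, ~~ odd (mup x p)) ->
  (forall x, 0 <= p.[x]) \/ (forall x, p.[x] <= 0).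
Proof.
have [n] := ubnP (size p); elim: n p => // n IH p szp p0 p_even.
case rE: (rootsR p) => [|x s].
  have pN x : ~~ root p x by rewrite -mem_rootsR // rE.
  have same x y : x <= y -> 0 < p.[x] * p.[y].
    move=> xy; rewrite ltNge; apply/negP => /(polyrcf.poly_ivt xy)[z _].
    exact/negP.
  have same0 x : 0 < p.[0] * p.[x].
    by case: (leP 0 x) => [/same//|/ltW/same]; rewrite mulrC.
  case: (ltP 0 p.[0]) => h; [left|right] => x; have := same0 x.
    by rewrite pmulr_rgt0 // => /ltW.
  by have [hx|//] := ltP 0 p.[x]; rewrite pmulr_lgt0 // ltNge h.
have px : root p x by rewrite -mem_rootsR // rE mem_head.
have : (2 <= mup x p)%N.
  have := p_even x; have : (0 < mup x p)%N by rewrite -XsubC_dvd // dvdp_XsubCl.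
  by case: (mup x p) => [|[|]].
rewrite mup_geq // => /dvdpP[h pE].
have h0 : h != 0 by apply: contraNneq p0 => h0; rewrite pE h0 mul0r.
have Xx0 : ('X - x%:P) ^+ 2 != 0 by rewrite expf_neq0 // polyXsubC_eq0.
have pH y : p.[y] = h.[y] * (y - x) ^+ 2.
  by rewrite pE hornerM horner_exp hornerXsubC.
have [|//|y|h_sign|h_sign] := IH h.
- by move: szp; rewrite pE size_Mmonic ?monic_exp ?monicXsubC //; rewrite size_exp_XsubC; lia.
- have := p_even y; rewrite pE mupM // mup_XsubCX oddD.
  by case: ifP; rewrite addbF.
- by left=> y; rewrite pH mulr_ge0 ?sqr_ge0.
by right=> y; rewrite pH mulr_le0_ge0 ?sqr_ge0.
Qed.

Lemma root_count_eq0 (R : rcfType) (p : {poly R}) :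
  (forall x, ~~ root p x) -> root_count p = 0%N.
Proof. by move=> pN; rewrite /root_count big1 // => x _; rewrite mupNroot. Qed.

(** A nonzero polynomial changes sign exactly at its roots of odd multiplicity. *)
Definition sign_changes (R : rcfType) (p : {poly R}) : nat :=
  size [seq x <- rootsR p | odd (mup x p)].

Lemma root_count_heat_prod (R : rcfType) (b : R) (f : {poly R}) (s : seq R) :
  0 < b -> f != 0 ->
  (root_count (heat b f)
    <= root_count (heat b (f * \prod_(r <- s) ('X - r%:P))) + size s)%N.
Proof.
move=> b0; elim: s f => [|r s IH] f f0; first by rewrite big_nil mulr1 addn0.
have fr0 : f * ('X - r%:P) != 0 by rewrite mulf_neq0 // polyXsubC_eq0.
rewrite big_cons mulrA /= addnS.
apply: (@leq_trans (root_count (heat b (f * ('X - r%:P)))).+1);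
  last by rewrite ltnS IH.
rewrite heatMXsubC root_count_shifted_op // ?heat_eq0 //.
by rewrite -heatMXsubC heat_eq0.
Qed.

(* The product of [f] and of the linear factors at its sign changes does not
   change sign, so the heat flow sends it to a polynomial without roots, while
   each linear factor costs at most one root by Rolle's theorem. *)
Lemma heat_variation_diminishing (R : realType) (b : R) (f : {poly R}) :
  0 < b -> f != 0 -> (root_count (heat b f) <= sign_changes f)%N.
Proof.
move=> b0 f0; set s := [seq x <- rootsR f | odd (mup x f)].
apply: leq_trans (root_count_heat_prod s b0 f0) _.
set h := f * _.
have pr0 : \prod_(r <- s) ('X - r%:P) != 0 by rewrite monic_neq0 // monic_prod_XsubC.
have h0 : h != 0 by rewrite mulf_neq0.
(* The added product raises precisely the odd multiplicities by one. *)
have h_even x : ~~ odd (mup x h).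
  rewrite mupM // mu_prod_XsubC oddD count_uniq_mem ?filter_uniq ?uniq_rootsR //.
  rewrite mem_filter mem_rootsR // oddb; case odd_x: (odd _) => //=.
  rewrite negbK -dvdp_XsubCl XsubC_dvd //.
  by case: (mup x f) odd_x.
rewrite root_count_eq0 // => x.
have [h_ge0|h_le0] := even_mup_constant_sign h0 h_even.
  by rewrite rootE gt_eqF // heat_gt0.
rewrite rootE lt_eqF // -oppr_gt0 -hornerN -scaleN1r -heatZ scaleN1r.
by rewrite heat_gt0 ?oppr_eq0 // => y; rewrite hornerN oppr_ge0.
Qed.

(** Compared root by root: a multiplicity of at least 2 is at least 3 when it is odd, which leaves
    room for both the sign change and the 2. *)
Lemma sign_changes_double_roots (R : rcfType) (p : {poly R}) (s : seq R) :
  p != 0 -> uniq s -> (forall x, x \in s -> (2 <= mup x p)%N) ->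
  (sign_changes p + 2 * size s <= root_count p)%N.
Proof.
move=> p0 us s_double.
have : (size s <= count (mem s) (rootsR p))%N.
  rewrite -size_filter; apply: uniq_leq_size => // x xs.
  rewrite mem_filter /= xs mem_rootsR // -dvdp_XsubCl XsubC_dvd //.
  exact: leq_trans (s_double x xs).
rewrite -(leq_pmul2l (isT : 0 < 2)%N) -(leq_add2l (sign_changes p)).
move=> /leq_trans; apply.
rewrite /sign_changes /root_count size_filter -!sum1_count.
rewrite [X in (X + _ <= _)%N]big_mkcond [X in (_ + 2 * X <= _)%N]big_mkcond /=.
rewrite big_distrr -big_split /=; apply: leq_sum => x _.
have := s_double x; case: (x \in s) => [/(_ isT)|_].
  by case: (mup x p) => [|[|[|]]] //= n; case: odd.
by case: (mup x p) => [|n] //=; case: odd.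
Qed.

(** * The upper bound *)

(** There are [d] linear conditions on [d.+1] coefficients. *)
Lemma exists_poly_kernel (F : fieldType) d (phi : nat -> {poly F} -> F) :
  (forall i k p q, phi i (k *: p + q) = k * phi i p + phi i q) ->
  exists f : {poly F}, [/\ f != 0, (size f <= d.+1)%N & forall i, (i < d)%N -> phi i f = 0].
Proof.
move=> phi_lin; pose M : 'M[F]_(d.+1, d) := \matrix_(i, j) phi j 'X^i.
have : kermx M != 0.
  by rewrite -mxrank_eq0 mxrank_ker subn_eq0 -ltnNge ltnS rank_leq_col.
case/rowV0Pn => v /sub_kermxP vM v0.
have phi0 i : phi i 0 = 0.
  by have := phi_lin i 1 0 0; rewrite scaler0 addr0 mul1r => /eqP;
    rewrite -subr_eq0 opprD addrA subrr sub0r oppr_eq0 => /eqP.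
exists (rVpoly v); split.
- apply: contraNneq v0 => v0; rewrite -[v]rVpolyK v0 linear0 //.
- exact: size_poly.
move=> i id; have /rowP/(_ (Ordinal id)) := vM; rewrite !mxE => vMi.
rewrite -[RHS]vMi /rVpoly poly_def.
elim/big_rec2: _ => [|j y1 y2 _ IH]; first exact: phi0.
by rewrite valK phi_lin IH mxE.
Qed.

Lemma double_root_mup (F : fieldType) (p : {poly F}) x :
  p != 0 -> root p x -> root p^`() x -> (2 <= mup x p)%N.
Proof.
move=> p0 /factor_theorem[g pE].
rewrite {1}pE derivM derivXsubC mulr1 rootE hornerD hornerM hornerXsubC subrr.
rewrite mulr0 add0r => gx; have /factor_theorem[h gE] : root g x by [].
by rewrite mup_geq // pE gE -mulrA -expr2 dvdp_mulIr.
Qed.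

Lemma exists_max_level (R : realDomainType) (s : seq (R * R)) :
  s != [::] -> exists2 z, z \in s & forall y, y \in s -> y.2 <= z.2.
Proof.
elim: s => // y s IH _; have [->|/IH[z zs z_max]] := eqVneq s [::].
  by exists y; rewrite ?mem_head // => x; rewrite inE => /eqP ->.
have [yz|zy] := leP y.2 z.2.
  by exists z; rewrite ?inE ?zs ?orbT // => x /predU1P[->//|/z_max].
exists y; rewrite ?mem_head // => x /predU1P[->//|/z_max xz].
exact: le_trans xz (ltW zy).
Qed.

(** A point is a pair (position, time of the flow), so these are the positions occurring at time
    [beta]. *)
Definition level (R : realDomainType) (s : seq (R * R)) (beta : R) : seq R :=
  [seq z.1 | z <- s & z.2 == beta].

Lemma uniq_level (R : realDomainType) (s : seq (R * R)) beta :
  uniq s -> uniq (level s beta).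
Proof.
move=> us; rewrite map_inj_in_uniq ?filter_uniq // => -[x1 x2] [y1 y2].
by rewrite !mem_filter /= => /andP[/eqP -> _] /andP[/eqP -> _] ->.
Qed.

Lemma mem_level (R : realDomainType) (s : seq (R * R)) x beta :
  (x \in level s beta) = ((x, beta) \in s).
Proof.
apply/mapP/idP => [[[y1 y2]]|xs]; last by exists (x, beta); rewrite ?mem_filter ?eqxx.
by rewrite mem_filter /= => /andP[/eqP <- ys ->].
Qed.

Definition double_on (R : rcfType) (s : seq (R * R)) (f : {poly R}) : Prop :=
  forall z, z \in s -> (2 <= mup z.1 (heat z.2 f))%N.

Lemma exists_double_on (R : rcfType) (s : seq (R * R)) :
  exists f : {poly R}, [/\ f != 0, (size f <= (2 * size s).+1)%N & double_on s f].
Proof.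
(* Each point imposes two conditions: the value at the even index and the derivative at the odd
   one. *)
pose phi i (f : {poly R}) := let z := nth (0, 0) s i./2 in
  if odd i then (heat z.2 f)^`().[z.1] else (heat z.2 f).[z.1].
have [|f [f0 szf phif]] := @exists_poly_kernel R (2 * size s) phi.
  move=> i k p q; rewrite /phi; case: odd; rewrite heatD heatZ.
    by rewrite derivD derivZ hornerD hornerZ.
  by rewrite hornerD hornerZ.
exists f; split=> // z /(nthP (0, 0))[i i_lt zE].
have := phif i.*2; rewrite /phi odd_double doubleK zE => f_z.
have := phif i.*2.+1; rewrite /phi /= odd_double uphalf_double zE /= => f'_z.
apply: double_root_mup; rewrite ?heat_eq0 // rootE.
  by rewrite f_z // mul2n ltn_double.
by rewrite f'_z // mul2n ltn_Sdouble.
Qed.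

Lemma sign_changes_level (R : rcfType) (s : seq (R * R)) (f : {poly R}) beta :
  uniq s -> f != 0 -> double_on s f ->
  (sign_changes (heat beta f) + 2 * size (level s beta)
     <= root_count (heat beta f))%N.
Proof.
move=> us f0 s_double; apply: sign_changes_double_roots.
- by rewrite heat_eq0.
- exact: uniq_level.
by move=> x; rewrite mem_level => /s_double.
Qed.

Definition count_below (R : realDomainType) (s : seq (R * R)) (beta : R) : nat :=
  count (fun z => z.2 < beta) s.

(** The degree allows at most [2 * size s] roots, and every point passed strictly before [beta]
    costs two. The induction goes back in time from one occupied level to the preceding one. *)
Lemma root_count_level (R : realType) (s : seq (R * R)) (f : {poly R}) beta :
  uniq s -> f != 0 -> (size f <= (2 * size s).+1)%N -> double_on s f ->
  (root_count (heat beta f) + 2 * count_below s beta <= 2 * size s)%N.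
Proof.
move=> us f0 szf s_double.
have [n] := ubnP (count_below s beta).
elim: n beta => // n IH beta; rewrite ltnS => count_n.
set t := [seq z <- s | z.2 < beta]; have [t0|/exists_max_level] := eqVneq t [::].
  rewrite /count_below -size_filter -/t t0 muln0 addn0 -ltnS.
  apply: leq_trans szf; apply: leq_trans (size_heat beta f).
  by rewrite root_count_lt_size ?heat_eq0.
case=> z; rewrite mem_filter => /andP[z_lt zs] z_max.
(* No point lies strictly between the times [z.2] and [beta], as [z] is a latest point before
   [beta]. *)
have split_count : count_below s beta =
    (count_below s z.2 + size (level s z.2))%N.
  rewrite /count_below size_map size_filter -count_predUI.
  rewrite [X in (_ + X)%N](@eq_count _ _ pred0) ?count_pred0 ?addn0; last first.
    by move=> y /=; case: ltgtP.
  apply: eq_in_count => y ys /=.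
  apply/idP/idP => [y_lt|/orP[/lt_trans|/eqP ->]]; last by [].
    by rewrite orbC -le_eqVlt z_max // mem_filter y_lt.
  exact.
have zb : 0 < beta - z.2 by rewrite subr_gt0.
have hf0 : heat z.2 f != 0 by rewrite heat_eq0.
have diminish := heat_variation_diminishing zb hf0.
rewrite heat_heat subrK in diminish.
have level_gt0 : (0 < size (level s z.2))%N.
  have : z.1 \in level s z.2 by rewrite mem_level -surjective_pairing.
  by case: (level s z.2).
rewrite split_count mulnDr (addnC (2 * _)%N) addnA.
apply: leq_trans (IH z.2 _); last first.
  by apply: leq_trans count_n; rewrite split_count -addn1 leq_add2l.
rewrite leq_add2r; apply: leq_trans (sign_changes_level z.2 us f0 s_double).
by rewrite leq_add2r.
Qed.

(** If [f] also vanished at [z], then at time [z.2] it would have this root and two for each point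
    of that level, one more than [root_count_level] permits. *)
Lemma exists_separating_heat (R : realType) (s : seq (R * R)) (z : R * R) :
  uniq s -> z \notin s -> (forall y, y \in s -> y.2 <= z.2) ->
  exists f : {poly R}, [/\ (size f <= (2 * size s).+1)%N,
    forall y, y \in s -> (heat y.2 f).[y.1] = 0 & (heat z.2 f).[z.1] != 0].
Proof.
move=> us zs z_max; have [f [f0 szf s_double]] := exists_double_on s.
exists f; split=> // [y /s_double|].
  move=> /ltnW; rewrite -XsubC_dvd ?heat_eq0 // dvdp_XsubCl.
  by move/rootP.
apply/negP => fz; have hf0 : heat z.2 f != 0 by rewrite heat_eq0.
have count_le : (mup z.1 (heat z.2 f) + \sum_(x <- level s z.2) mup x (heat z.2 f)
    <= root_count (heat z.2 f))%N.
  have /(sum_mup_le_root_count hf0) : uniq (z.1 :: level s z.2).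
    by rewrite /= mem_level -surjective_pairing zs uniq_level.
  by rewrite big_cons.
have mup_gt0 : (0 < mup z.1 (heat z.2 f))%N by rewrite -XsubC_dvd // dvdp_XsubCl.
have mup_level : (2 * size (level s z.2)
    <= \sum_(x <- level s z.2) mup x (heat z.2 f))%N.
  rewrite -sum1_size big_distrr /= !big_seq; apply: leq_sum => x.
  by rewrite mem_level => /s_double.
(* Maximality of [z.2] leaves no point of [s] at a later time. *)
have size_s : size s = (count_below s z.2 + size (level s z.2))%N.
  rewrite /count_below size_map size_filter -[LHS](count_predC (fun y => y.2 < z.2)).
  congr (_ + _)%N; apply: eq_in_count => y /z_max y_le /=.
  by rewrite -leNgt eq_le y_le.
have := root_count_level z.2 us f0 szf s_double.
rewrite size_s mulnDr addnC leq_add2l leqNgt => /negP; apply.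
exact: leq_trans (leq_add mup_gt0 mup_level) count_le.
Qed.

(** * The system as an identity for the heat flow *)

Lemma horner_heatXn (R : numFieldType) (b x : R) k :
  (heat b 'X^k).[x] = k`!%:R *
    \sum_(n1 < k.+1) \sum_(n2 < k.+1 | (n1 + 2 * n2 == k)%N)
      (x ^+ n1 * b ^+ n2) / (n1`!%:R * n2`!%:R).
Proof.
have char0 n : n.+1%:R != 0 :> R by rewrite pnatr_eq0.
have fact0 n : n`!%:R != 0 :> R by exact: natr_neq0_fact.
rewrite (heat_expansion b char0 (_ : size 'X^k <= k.+1)%N) ?size_polyXn //.
under [in RHS]eq_bigr do rewrite big_mkcond.
rewrite [in RHS]exchange_big mulr_sumr horner_sum; apply: eq_bigr => n2 _ /=.
rewrite -big_mkcond derivnXn hornerZ hornerMn hornerXn.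
(* For fixed [n2] the inner sum has the single index $n_1 = k - 2 n_2$, or none if $2 n_2 > k$, when
   the derivative vanishes as well. *)
have [le_k|lt_k] := leqP (2 * n2) k; last first.
  rewrite ffact_small // mulr0n mulr0 big_pred0 ?mulr0 // => n1.
  by apply/negbTE; rewrite neq_ltn; apply/orP; right; apply: ltn_addl.
have lt_sub : (k - 2 * n2 < k.+1)%N by rewrite ltnS leq_subr.
rewrite (big_pred1 (Ordinal lt_sub)) /= => [|n1]; last first.
  by rewrite -[RHS]/(n1 == Ordinal lt_sub) -val_eqE /= -[RHS](eqn_add2r (2 * n2)) subnK.
rewrite -(ffact_fact le_k) natrM -mulr_natr; field.
by rewrite !fact0.
Qed.

Lemma equation_lhsE (R : realType) m (c a b : 'I_m -> R) k :
  k`!%:R * equation_lhs c a b k = \sum_(j < m) c j ^+ 2 * (heat (b j) 'X^k).[a j].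
Proof.
rewrite mulr_sumr; apply: eq_bigr => j _; rewrite horner_heatXn mulrCA; congr (_ * _).
rewrite mulr_sumr; apply: eq_bigr => n1 _; rewrite mulr_sumr.
by apply: eq_bigr => n2 _; rewrite !mulrA.
Qed.

(** By linearity it suffices to treat monomials: constants are fixed by the flow, and $X^i$ with $1
    \le i \le r$ gives the equation of index $i$. *)
Lemma solves_systemP (R : realType) m r (c a b : 'I_m -> R) (f : {poly R}) :
  solves_system r c a b -> (size f <= r.+1)%N ->
  \sum_(j < m) c j ^+ 2 * (heat (b j) f).[a j] = \sum_(j < m) c j ^+ 2 * f.[0].
Proof.
move=> sol szf; apply/eqP; rewrite -subr_eq0 -sumrB; apply/eqP.
rewrite -[f]coefK poly_def.
apply: (big_ind (fun g =>
  \sum_(j < m) (c j ^+ 2 * (heat (b j) g).[a j] - c j ^+ 2 * g.[0]) = 0)).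
- by rewrite big1 // => j _; rewrite heat0 !horner0 !mulr0 subrr.
- move=> g h gE hE.
  under eq_bigr do rewrite heatD !hornerD !mulrDr opprD addrACA.
  by rewrite big_split /= gE hE addr0.
move=> [i i_lt] _ /=.
have -> : \sum_(j < m) (c j ^+ 2 * (heat (b j) (f`_i *: 'X^i)).[a j]
      - c j ^+ 2 * (f`_i *: 'X^i).[0])
    = f`_i * \sum_(j < m) (c j ^+ 2 * (heat (b j) 'X^i).[a j] - c j ^+ 2 * 0 ^+ i).
  rewrite mulr_sumr; apply: eq_bigr => j _.
  by rewrite heatZ !hornerZ hornerXn; ring.
case: i i_lt => [|i] i_lt.
  rewrite big1 ?mulr0 // => j _.
  by rewrite expr0 -[1]/(1%:P) heatC hornerC expr0 subrr.
under eq_bigr do rewrite expr0n /= mulr0 subr0.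
rewrite -equation_lhsE sol ?mulr0 //=.
by rewrite -ltnS (leq_trans i_lt).
Qed.

Lemma no_nontrivial_solution_double (R : realType) m :
  no_nontrivial_solution R m (2 * m).
Proof.
case=> c [a [b [sol [c0 [j0 aj0]]]]].
pose pts := [seq (a j, b j) | j <- enum 'I_m].
(* The origin carries the right-hand side [f.[0]]. Duplicates are removed because several indices
   may share a point. *)
pose s := undup ((0, 0) :: pts).
have mem_pts j : (a j, b j) \in s.
  by rewrite mem_undup inE map_f ?orbT ?mem_enum.
have [|z zs z_max] := @exists_max_level _ s.
  by apply/eqP => s0; have := mem_pts j0; rewrite s0.
have us : uniq s by exact: undup_uniq.
(* Of at most [m + 1] points one is dropped, which gives the degree bound [2 * m]. *)
have size_s : (size (rem z s) <= m)%N.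
  rewrite size_rem // -ltnS prednK; last by case: (s) zs.
  apply: leq_trans (size_undup _) _.
  by rewrite /= size_map -cardE card_ord.
have [||f [szf f_rem f_z]] := @exists_separating_heat _ (rem z s) z (rem_uniq z us).
- by rewrite mem_rem_uniqF.
- by move=> y /mem_rem; exact: z_max.
have f_s y : y \in s -> (heat y.2 f).[y.1] = if y == z then (heat z.2 f).[z.1] else 0.
  by move=> ys; case: eqP => [->//|/eqP yz]; rewrite f_rem // mem_rem_uniq // !inE yz.
have szf' : (size f <= (2 * m).+1)%N.
  by apply: leq_trans szf _; rewrite ltnS leq_mul2l.
have := solves_systemP sol szf'.
have -> : f.[0] = if (0, 0) == z then (heat z.2 f).[z.1] else 0.
  by rewrite -f_s ?heat_id // mem_undup mem_head.
have weight_neq0 (P : pred 'I_m) j :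
    P j -> \sum_(i | P i) c i ^+ 2 * (heat z.2 f).[z.1] != 0.
  move=> Pj; rewrite -mulr_suml mulf_neq0 // gt_eqF // (bigD1 j) //=.
  rewrite ltr_pwDl ?sumr_ge0 // => [|i _]; last exact: sqr_ge0.
  by rewrite exprn_even_gt0 //=; apply/eqP.
under eq_bigr do rewrite (f_s _ (mem_pts _)) fun_if mulr0.
(* If [z] is the origin, subtracting the two sides leaves the weight of the indices away from the
   origin, among them [j0]. Otherwise the right side is zero and the left side is the weight at
   [z]. *)
rewrite -big_mkcond; case: eqP => [z0|/eqP z0].
  rewrite [RHS](bigID (fun j => (a j, b j) == z)) /= => /eqP.
  rewrite eq_sym -subr_eq0 addrC addrK; apply/negP; apply: (weight_neq0 _ j0).
  by rewrite -z0; apply/eqP => -[].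
under [RHS]eq_bigr do rewrite mulr0.
rewrite big1_eq; apply/eqP.
have : z \in pts.
  by move: zs; rewrite mem_undup inE eq_sym (negPf z0).
by case/mapP => j _ zE; apply: (weight_neq0 _ j); rewrite zE.
Qed.

(** * Explicit solutions *)

(** The three-term recurrence of the Hermite polynomials, used to evaluate the explicit
    solutions. *)
Lemma horner_heat_rec (R : comNzRingType) (b x : R) k :
  (heat b 'X^(k.+2)).[x]
    = x * (heat b 'X^(k.+1)).[x] + 2 * b * k.+1%:R * (heat b 'X^k).[x].
Proof.
rewrite exprSr heatMX /hermite_op hornerD hornerMX hornerZ mulrC; congr (_ + _).
by rewrite -heat_deriv derivXn -scaler_nat heatZ hornerZ mulrA.
Qed.

Lemma horner_heat0 (R : comNzRingType) (b x : R) : (heat b 'X^0).[x] = 1.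
Proof. by rewrite expr0 -[1]/(1%:P) heatC hornerC. Qed.

Lemma horner_heat1 (R : comNzRingType) (b x : R) : (heat b 'X^1).[x] = x.
Proof.
rewrite -[X in heat _ X]mul1r heatMX -[1]/(1%:P) heatC /hermite_op derivC.
by rewrite scaler0 addr0 mul1r hornerX.
Qed.

(** A triple lists the weight $c^2$, then $a$ and $b$. Missing indices are filled with the default
    [(1, 0, 0)], which contributes nothing to the equations of index at least 1. *)
Lemma nontrivial_solution_of_seq (R : realType) (s : seq (R * R * R)) m r :
  (size s <= m)%N -> {in s, forall t, 0 < t.1.1} -> has (fun t => t.1.2 != 0) s ->
  (forall k, (1 <= k <= r)%N ->
     \sum_(t <- s) t.1.1 * (heat t.2 'X^k).[t.1.2] = 0) ->
  ~ no_nontrivial_solution R m r.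
Proof.
move=> size_s s_gt0 s_neq0 s_sol; apply.
pose t j := nth (1, 0, 0) s j.
exists (fun j => Num.sqrt (t j).1.1), (fun j => (t j).1.2), (fun j => (t j).2).
have t_gt0 j : 0 < (t j).1.1.
  have [lt_j|le_j] := ltnP j (size s); first by rewrite s_gt0 // mem_nth.
  by rewrite /t nth_default.
split; last split.
- move=> k k_bounds; have k_fact : k`!%:R != 0 :> R by rewrite pnatr_eq0 -lt0n fact_gt0.
  apply: (mulfI k_fact); rewrite mulr0 equation_lhsE.
  under eq_bigr do rewrite sqr_sqrtr ?ltW //.
  rewrite -(big_mkord xpredT (fun j => (t j).1.1 * (heat (t j).2 'X^k).[(t j).1.2])).
  rewrite (big_cat_nat (leq0n _) size_s) /= -(big_nth _ xpredT
    (fun u => u.1.1 * (heat u.2 'X^k).[u.1.2])) s_sol // add0r.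
  rewrite big_nat big1 // => j /andP[le_j _].
  by rewrite /t nth_default //= heat_id hornerXn mul1r expr0n; case: k k_bounds k_fact.
- by move=> j; apply/eqP; rewrite gt_eqF // sqrtr_gt0.
have /(has_nthP (1, 0, 0))[j lt_j tj] := s_neq0.
by exists (Ordinal (leq_trans lt_j size_s)); apply/eqP.
Qed.

Lemma no_nontrivial_solution_mono (R : realType) m r r' :
  (r <= r')%N -> no_nontrivial_solution R m r -> no_nontrivial_solution R m r'.
Proof.
move=> le_r no_sol [c [a [b [sol nontriv]]]]; apply: no_sol.
exists c, a, b; split=> // k /andP[k_gt0 k_le].
by apply: sol; rewrite k_gt0 (leq_trans k_le).
Qed.

(* The three solutions below are invariant under [a -> -a], so that the
   equations of odd index hold automatically. *)
Lemma exists_solution2 (R : realType) : ~ no_nontrivial_solution R 2 3.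
Proof.
(* The value $b = -1/2$ makes $a^2 + 2b$ vanish at $a = \pm 1$. *)
apply: (@nontrivial_solution_of_seq R [:: (1, 1, - 2^-1); (1, -1, - 2^-1)]) => //.
- by move=> t; rewrite !inE => /orP[] /eqP -> /=.
- by rewrite /= oner_eq0.
case=> [|[|[|[|k]]]] // _; rewrite !big_cons big_nil;
  rewrite ?horner_heat_rec ?horner_heat1 ?horner_heat0 /=; by field.
Qed.

(* The nodes and weights of the Gauss-Hermite quadrature with three points. *)
Lemma exists_solution3 (R : realType) : ~ no_nontrivial_solution R 3 5.
Proof.
(* Running the flow backwards for time $1/6$ cancels a Gaussian of variance $1/3$, for which this
   quadrature is exact up to degree 5. *)
apply: (@nontrivial_solution_of_seq R
  [:: (1, 1, - 6^-1); (1, -1, - 6^-1); (4, 0, - 6^-1)]) => //.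
- by move=> t; rewrite !inE => /or3P[] /eqP -> /=.
- by rewrite /= oner_eq0.
case=> [|[|[|[|[|[|k]]]]]] // _; rewrite !big_cons big_nil;
  rewrite ?horner_heat_rec ?horner_heat1 ?horner_heat0 /=; by field.
Qed.

Lemma exists_solution4 (R : realType) m :
  (4 <= m)%N -> ~ no_nontrivial_solution R m 6.
Proof.
(* At $a = \pm 1$, $b = -1/2$ the heat polynomials of degrees 2, 4, 6 are $0, -2, 16$; at $a = 0$
   they are $2b, 12b^2, 120b^3$. The weights balance the totals: $30 - 30$, $576 - 576$ and $4608 -
   4608$. *)
move=> m_ge4; apply: (@nontrivial_solution_of_seq R
  [:: (144, 1, - 2^-1); (144, -1, - 2^-1); (75, 0, 2 / 5); (25, 0, - (6 / 5))]) => //.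
- by move=> t; rewrite !inE => /or4P[] /eqP -> /=.
- by rewrite /= oner_eq0.
case=> [|[|[|[|[|[|[|k]]]]]]] // _; rewrite !big_cons big_nil;
  rewrite ?horner_heat_rec ?horner_heat1 ?horner_heat0 /=; by field.
Qed.

Theorem proposition4p2 (R : realType) (k0 k : nat) (hk0 : (1 <= k0)%N)
    (hk : (k0 + 1 <= k)%N) :
  exists r : nat,
    [/\ is_rbar R k0 k r,
        (k - k0 = 1)%N -> r = 4%N,
        (k - k0 = 2)%N -> r = 6%N
      & (3 <= k - k0)%N -> (7 <= r)%N].
Proof.
set m := (k - k0 + 1)%N.
pose P r := (1 <= r)%N && `[< no_nontrivial_solution R m r >].
have P_double : P (2 * m)%N.
  by apply/andP; split; [lia | apply/asboolP; exact: no_nontrivial_solution_double].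
have [r /andP[r_gt0 /asboolP r_no] r_min] := ex_minnP (ex_intro P _ P_double).
(* Unsolvability persists when equations are added, so any solvable system has fewer than [r]
   equations. *)
have r_gt s : ~ no_nontrivial_solution R m s -> (s < r)%N.
  move=> s_sol; rewrite ltnNge; apply/negP => /no_nontrivial_solution_mono.
  by move/(_ R m r_no).
have r_le : (r <= 2 * m)%N by exact: r_min.
exists r; split=> [|k1|k2|k3].
- split=> // s s_gt0 s_no; apply: r_min.
  by rewrite /P s_gt0; apply/asboolP.
(* For [m] equal to 2 or 3 the explicit solution satisfies [2 * m - 1] equations, so the upper bound
   [2 * m] is attained. *)
- have m2 : m = 2%N by rewrite /m k1.
  move: r_le (r_gt 3%N); rewrite m2 => r_le /(_ (@exists_solution2 R)).
  by move=> ?; apply/eqP; rewrite eqn_leq r_le.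
- have m3 : m = 3%N by rewrite /m k2.
  move: r_le (r_gt 5%N); rewrite m3 => r_le /(_ (@exists_solution3 R)).
  by move=> ?; apply/eqP; rewrite eqn_leq r_le.
by apply: r_gt; apply: exists_solution4; rewrite /m addn1.
Qed.
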